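(* Let $q$ be a power of an odd prime and let $A\subset \mathbb{F}_q$ with $|A|\ge 2$. There exist subsets $C\subseteq B\subseteq A$, with $|A|\ll |B| \ll (\log|A|)^{2} |C|$, such that \[ \mathsf{E}(B)\,\mathsf{E}^{\times}(C) \ll \frac{|A|^7\log|A|}{q} + |A|^4(\log|A|)^2q . \]
   Context: For a set $B\subseteq\mathbb{F}_q$, $\mathsf{E}(B)=|\{(b_1,b_2,b_3,b_4)\in B^4: b_1-b_2=b_3-b_4\}|$ is the additive energy. The multiplicative energy is $\mathsf{E}^\times(C)=\sum_{x\in C/C} r_{C/C}(x)^2$, where $C/C=\{a/b: a,b\in C,\ b\neq 0\}$ and $r_{C/C}(x)=|\{(a,b)\in C\times C: b\ne0,\ a/b=x\}|$ (division by zero is not considered). $\alpha\ll\beta$ means $|\alpha|\le c\beta$ for an absolute constant $c>0$ (independent of $q$ and $A$). *)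

(* Defs.v *)
From HB Require Import structures.
From mathcomp Require Import all_boot all_order all_algebra.

Set Implicit Arguments.
Unset Strict Implicit.
Unset Printing Implicit Defensive.

Import GRing.Theory.
Local Open Scope ring_scope.

(* The quadruple (b1, b2, b3, b4) is encoded as the nested pair (((b1, b2), b3), b4). *)
Definition add_energy (F : finFieldType) (B : {set F}) : nat :=
  #|[set t : F * F * F * F |
      let: (b1, b2, b3, b4) := t in
      [&& b1 \in B, b2 \in B, b3 \in B, b4 \in B & b1 - b2 == b3 - b4]]|.

Definition quot_set (F : finFieldType) (C : {set F}) : {set F} :=
  [set a / b | a in C, b in C & b != 0].

(* MathComp sets 0^-1 = 0, so the guard b != 0 is what excludes division by zero. *)
Definition quot_repr (F : finFieldType) (C : {set F}) (x : F) : nat :=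
  #|[set ab : F * F |
      [&& ab.1 \in C, ab.2 \in C, ab.2 != 0 & ab.1 / ab.2 == x]]|.

Definition mul_energy (F : finFieldType) (C : {set F}) : nat :=
  (\sum_(x in quot_set C) quot_repr C x ^ 2)%N.

(* Main.v *)
Require Import Defs.
From mathcomp Require Import all_boot all_order all_algebra.
From mathcomp Require Import zify ring lra.
From mathcomp Require Import reals exp.

Set Implicit Arguments.
Unset Strict Implicit.
Unset Printing Implicit Defensive.

Import Order.TTheory GRing.Theory Num.Theory.
Local Open Scope ring_scope.

(** Write n = |A|, q = |F|, v(d) for the number of representations of d as a
    difference of two elements of B, and e_B(c) = sum_(a in B) v(c - a), the
    number of additive quadruples of B with first entry c.  Thus E(B) is the
    sum of e_B over B.

    Choice of B and C.  Call c in B popular when e_B(c) is at least half of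
    the average E(B)/|B|, and let C be the set of popular elements of B.  It may
    be small, but discarding it from B at least halves the energy, because
    the remaining elements all have small e_B.  The energy of a subset of A
    with at least n/2 elements lies between n^2/4 and n^3, so fewer than
    J = log_2 n + O(1) halvings are possible.  Hence, if A is peeled in this
    way, some set B met before half of A is lost has at least n/(2J) popular
    elements ([exists_large_popular_part]).

    The energy bound.  Let w be the representation function of C/C, and M the
    sum of w^2, so M bounds the multiplicative energy of C.  A
    representation c = x c' of the ratio x comes with e_B(c) >= E(B)/(2|B|)
    pairs counted by sum_(a in B) v(x c' - a).  Hence E(B) M / (2|B|) is at most
      sum_((c', a) in C x B) sum_x w(x) v(c' x - a),
    the number of incidences between the lines y = c' x - a, with (c', a) in
    C x B, and the points (x, y), weighted by w(x) v(y)
    ([popular_energy_incidences]).  Over F such a number deviates from its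
    expected value |C||B| (sum w)(sum v) / q by at most
    sqrt(q |C||B| M E(B)), by a second moment computation over all lines
    ([weighted_incidence_bound]).  As sum w <= n^2, sum v <= n^2 and
    sum v^2 = E(B), this reads
      E(B) M <= 2 n (n^6/q + n sqrt(q E(B) M)),
    whence E(B) M <= 16 (n^7/q + n^4 q) ([energy_product_bound]).  Keeping
    the weights w and v, instead of restricting to dyadic level sets, is what
    avoids any logarithmic loss here.  The logarithms in the final bounds are
    then inserted by means of ln n >= ln 2. *)

(** * Additive energy and popular elements *)

Definition diff_repr (F : finFieldType) (B : {set F}) (d : F) : nat :=
  (\sum_(b in B) ((b - d)%R \in B))%N.

Definition energy_at (F : finFieldType) (B : {set F}) (c : F) : nat :=
  (\sum_(a in B) diff_repr B (c - a)%R)%N.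

Section Energy.
Variable F : finFieldType.
Implicit Types (B : {set F}) (c d : F).

Lemma sum_diff_reprM (T : pzSemiRingType) B (g : F -> T) :
  \sum_(c in B) \sum_(a in B) g (c - a) = \sum_d (diff_repr B d)%:R * g d.
Proof.
rewrite /diff_repr.
under [RHS]eq_bigr => d _ do rewrite natr_sum mulr_suml.
rewrite [RHS]exchange_big /=; apply: eq_bigr => c _.
rewrite (reindex_inj (inv_inj (subKr c))) /=.
rewrite big_mkcond /=; apply: eq_bigr => a _.
rewrite subKr.
by case: ifP => _; rewrite ?mul1r ?mul0r.
Qed.

Lemma sum_quadruples (f : F * F * F * F -> nat) :
  (\sum_t f t = \sum_b1 \sum_b2 \sum_b3 \sum_b4 f (b1, b2, b3, b4))%N.
Proof. by rewrite !pair_bigA /=; apply: eq_bigr => -[[[b1 b2] b3] b4]. Qed.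

Lemma add_energyE B : add_energy B = (\sum_(c in B) energy_at B c)%N.
Proof.
rewrite /add_energy -sum1_card big_mkcond sum_quadruples [RHS]big_mkcond /=.
apply: eq_bigr => b1 _.
rewrite /energy_at; case: ifP => B1; last first.
  by do 3! [rewrite big1 // => ? _]; rewrite inE B1.
rewrite [RHS]big_mkcond; apply: eq_bigr => b2 _.
rewrite /diff_repr; case: ifP => B2; last first.
  by do 2! [rewrite big1 // => ? _]; rewrite inE B1 B2.
rewrite [RHS]big_mkcond; apply: eq_bigr => b3 _.
case: ifP => B3; last first.
  by rewrite big1 // => ? _; rewrite inE B1 B2 B3.
(* The first three entries of an additive quadruple determine the fourth. *)
rewrite (bigD1 (b3 - (b1 - b2))%R) //= big1 ?addn0 => [|b4 ne4].
  by rewrite inE B1 B2 B3 subKr eqxx andbT /=; case: (_ \in B).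
rewrite inE B1 B2 B3 /=; case: eqP => [eq4|_]; last by rewrite andbF.
by rewrite eq4 subKr eqxx in ne4.
Qed.

Lemma sum_sqr_diff_repr (T : pzSemiRingType) B :
  \sum_d (diff_repr B d)%:R ^+ 2 = (add_energy B)%:R :> T.
Proof.
rewrite add_energyE /energy_at natr_sum.
under [RHS]eq_bigr => c _ do rewrite natr_sum.
rewrite (sum_diff_reprM B (fun d => (diff_repr B d)%:R : T)).
by apply: eq_bigr => d _; rewrite expr2.
Qed.

Lemma sum_diff_repr (T : pzSemiRingType) B :
  \sum_d (diff_repr B d)%:R = (#|B| ^ 2)%:R :> T.
Proof.
under eq_bigr => d _ do rewrite -[_%:R]mulr1.
rewrite -(sum_diff_reprM B (fun=> 1 : T)).
by rewrite sumr_const sumr_const -mulrnA mulnn.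
Qed.

Lemma energy_at_mono B1 B2 c : B1 \subset B2 -> (energy_at B1 c <= energy_at B2 c)%N.
Proof.
move=> /subsetP sB.
have le_sum (f g : F -> nat) : (forall x, f x <= g x)%N ->
    (\sum_(x in B1) f x <= \sum_(x in B2) g x)%N.
  move=> le_fg; rewrite big_mkcond [X in (_ <= X)%N]big_mkcond /=.
  apply: leq_sum => x _; case: ifP => [/sB ->|_ //]; exact: le_fg.
apply: (le_sum) => a; apply: (le_sum) => b.
by case: (boolP (_ \in B1)) => [/sB ->|].
Qed.

(** The quadruples (c, a, c, a) are already |B|^2 many. *)
Lemma add_energy_ge B : (#|B| ^ 2 <= add_energy B)%N.
Proof.
rewrite add_energyE -mulnn -sum_nat_const; apply: leq_sum => c Bc.
rewrite -sum1_card; apply: leq_sum => a Ba.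
by rewrite /diff_repr (bigD1 c) //= subKr Ba.
Qed.

Lemma add_energy_le B : (add_energy B <= #|B| ^ 3)%N.
Proof.
rewrite add_energyE expnS -sum_nat_const; apply: leq_sum => c _.
rewrite -mulnn -sum_nat_const; apply: leq_sum => a _.
by rewrite -sum1_card; apply: leq_sum => b _; case: (_ \in B).
Qed.

(** The elements taking part in at least half as many additive quadruples as an
    average element of B; the inequality e_B(c) >= E(B)/(2|B|) is cleared of
    denominators. *)
Definition popular_part B : {set F} :=
  [set c in B | add_energy B <= 2 * #|B| * energy_at B c]%N.

Lemma popular_part_sub B : popular_part B \subset B.
Proof. by apply/subsetP => c; rewrite inE => /andP[]. Qed.

(** Each of the at most |B| unpopular elements c has e_B(c) < E(B)/(2|B|), and
    passing from e_B to the energy of a subset can only lose quadruples. *)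
Lemma add_energy_unpopular B :
  (2 * add_energy (B :\: popular_part B) <= add_energy B)%N.
Proof.
set D := B :\: _.
have sDB : D \subset B by apply: subsetDl.
have [B0|B_gt0] := posnP #|B|.
  have -> : D = B by apply/eqP; rewrite eqEcard sDB B0.
  by have := add_energy_le B; rewrite B0 leqn0 => /eqP->.
rewrite -(leq_pmul2l B_gt0).
apply: (@leq_trans (\sum_(c in D) add_energy B)%N); last first.
  by rewrite sum_nat_const leq_mul2r subset_leq_card ?orbT.
rewrite mulnA (mulnC #|B|) {1}[add_energy D]add_energyE big_distrr /=.
apply: leq_sum => c; rewrite !inE => /andP[+ Bc]; rewrite Bc /= -ltnNge => lt_c.
by apply/ltnW/(leq_ltn_trans _ lt_c); rewrite leq_mul2l energy_at_mono ?orbT.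
Qed.

(** Energy decrement: as long as the popular part has fewer than |A|/(2J)
    elements, removing it halves the energy at little cost in size.  After J
    such steps at least half of A would be left, with energy at most
    |A|^3 / 2^J < |A|^2 / 4, which is below the trivial lower bound. *)
Lemma exists_large_popular_part (A : {set F}) (J : nat) :
    (0 < #|A|)%N -> (4 * #|A| < 2 ^ J)%N ->
  exists B, [/\ B \subset A, (#|A| <= 2 * #|B|)%N
              & (#|A| <= 2 * J * #|popular_part B|)%N].
Proof.
move=> A_gt0 J_large.
have J_gt0 : (0 < J)%N by case: (J) J_large => // ; rewrite expn0; lia.
have [/existsP[B /and3P[]]|none] := boolP [exists B : {set F},
  [&& B \subset A, #|A| <= 2 * #|B| & #|A| <= 2 * J * #|popular_part B|]%N].
  by exists B.
have small B : B \subset A -> (#|A| <= 2 * #|B| ->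
    2 * J * #|popular_part B| < #|A|)%N.
  move=> sBA leB; rewrite ltnNge; apply: contra none => leP.
  by apply/existsP; exists B; rewrite sBA leB.
have peel j : (j <= J)%N -> exists B, [/\ B \subset A,
    (2 * J * #|A| <= 2 * J * #|B| + j * #|A|)%N
    & (2 ^ j * add_energy B <= add_energy A)%N].
  elim: j => [_|j IHj lt_jJ]; first by exists A; rewrite mul1n addn0.
  have [B [sBA szB enB]] := IHj (ltnW lt_jJ).
  have leB : (#|A| <= 2 * #|B|)%N.
    rewrite -(leq_pmul2l J_gt0).
    have : (j * #|A| <= J * #|A|)%N by rewrite leq_mul2r (ltnW lt_jJ) orbT.
    nia.
  exists (B :\: popular_part B); split.
  - exact: subset_trans (subsetDl _ _) sBA.
  - have ltP := small B sBA leB.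
    have := cardsID (popular_part B) B.
    by rewrite (setIidPr (popular_part_sub B)) mulSn; nia.
  - rewrite expnSr -mulnA; apply: leq_trans enB.
    by rewrite leq_mul2l add_energy_unpopular orbT.
have [B [sBA szB enB]] := peel J (leqnn J).
have leB : (#|A| <= 2 * #|B|)%N by rewrite -(leq_pmul2l J_gt0); nia.
have le2 : (2 ^ J * #|A| ^ 2 <= 4 * #|A| * #|A| ^ 2)%N.
  apply: (@leq_trans (4 * (2 ^ J * add_energy B))%N).
    rewrite mulnCA leq_mul2l; apply/orP; right.
    apply: (@leq_trans (4 * #|B| ^ 2)%N); last by rewrite leq_mul2l add_energy_ge.
    by rewrite -(expnMn 2 _ 2) leq_sqr.
  by rewrite -mulnA -expnS leq_mul2l (leq_trans enB) ?add_energy_le.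
by move: le2; rewrite leq_pmul2r ?expn_gt0 ?A_gt0 // leqNgt J_large.
Qed.

End Energy.

(** * Weighted point-line incidences *)

Section Incidence.
Variables (R : realFieldType) (F : finFieldType) (w v : F -> R).

(* The pair l = (c, a) stands for the line y = c x - a, and Phi l is the total
   weight of its points (x, y), each of weight w x * v y. *)
Let Phi (l : F * F) : R := \sum_x w x * v (l.1 * x - l.2).
Let W := \sum_x w x.
Let V := \sum_y v y.
Let W2 := \sum_x w x ^+ 2.
Let V2 := \sum_y v y ^+ 2.
Let q : R := #|F|%:R.

(** Every point lies on exactly q non-vertical lines, one for each slope. *)
Lemma sum_lines_point (g : F -> R) x :
  \sum_(l : F * F) g (l.1 * x - l.2) = q * \sum_y g y.
Proof.
rewrite -(pair_bigA _ (fun c a => g (c * x - a))) /=.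
rewrite /q mulr_natl -sumr_const; apply: eq_bigr => c _.
by rewrite [RHS](reindex_inj (inv_inj (subKr (c * x)))) /=.
Qed.

(** Points on two distinct vertical lines are joined by exactly one line. *)
Lemma sum_lines_two_points (g h : F -> R) x x' : x != x' ->
  \sum_(l : F * F) g (l.1 * x - l.2) * h (l.1 * x' - l.2)
    = (\sum_y g y) * (\sum_y h y).
Proof.
move=> neq_x; have dx : x - x' != 0 by rewrite subr_eq0.
rewrite big_distrlr /= (pair_bigA _ (fun y z => g y * h z)) /=.
rewrite [RHS](reindex (fun l : F * F => (l.1 * x - l.2, l.1 * x' - l.2))) //.
exists (fun y : F * F => let c := (y.1 - y.2) / (x - x') in (c, c * x - y.1)).
  move=> [c a] _ /=; have -> : (c * x - a - (c * x' - a)) / (x - x') = c by field.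
  by rewrite subKr.
move=> [y z] _ /=; rewrite subKr; congr (_, _).
by field.
Qed.

(** In the second moment of Phi the pairs of points with distinct abscissas
    contribute as if they were independent, because exactly one line joins
    them; that part cancels against the square of the mean W V / q.  Of the
    pairs with equal abscissas only coincident points share a line, and these
    give the bound. *)
Lemma incidence_variance :
  \sum_l (Phi l - W * V / q) ^+ 2 <= q * W2 * V2.
Proof.
have q_neq0 : q != 0 by rewrite pnatr_eq0 -lt0n; apply/card_gt0P; exists 0.
have sumPhi : \sum_l Phi l = q * W * V.
  rewrite exchange_big /=.
  under eq_bigr => x _ do rewrite -mulr_sumr sum_lines_point.
  by rewrite -mulr_suml -/W -/V; ring.
have sumPhi2 : \sum_l Phi l ^+ 2 = q * W2 * V2 + V ^+ 2 * (W ^+ 2 - W2).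
  transitivity (\sum_x \sum_x' w x * w x' *
      (if x == x' then q * V2 else V ^+ 2)).
    under eq_bigr => l _ do rewrite expr2 big_distrlr /=.
    rewrite exchange_big /=; apply: eq_bigr => x _.
    rewrite exchange_big /=; apply: eq_bigr => x' _.
    under eq_bigr => l _ do rewrite mulrACA.
    rewrite -mulr_sumr; congr (_ * _); have [<-|ne] := eqVneq.
      under eq_bigr => l _ do rewrite -expr2.
      by rewrite (sum_lines_point (fun y => v y ^+ 2)).
    by rewrite sum_lines_two_points // expr2.
  transitivity (\sum_x (w x ^+ 2 * (q * V2 - V ^+ 2) + w x * (W * V ^+ 2))).
    apply: eq_bigr => x _.
    rewrite (bigD1 x) //= eqxx /W [in RHS](bigD1 x) //=.
    under eq_bigr => x' ne do rewrite eq_sym (negPf ne).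
    rewrite -mulr_suml -mulr_sumr; ring.
  by rewrite big_split /= -!mulr_suml -/W -/W2; ring.
have -> : \sum_l (Phi l - W * V / q) ^+ 2 =
    \sum_l (Phi l ^+ 2 - 2 * (W * V / q) * Phi l + (W * V / q) ^+ 2).
  by apply: eq_bigr => l _; ring.
rewrite big_split sumrB /= -mulr_sumr sumPhi sumPhi2 sumr_const card_prod.
rewrite -[_ *+ (_ * _)]mulr_natl natrM -/q.
have -> : q * W2 * V2 + V ^+ 2 * (W ^+ 2 - W2) - 2 * (W * V / q) * (q * W * V)
    + q * q * (W * V / q) ^+ 2 = q * W2 * V2 - V ^+ 2 * W2 by field.
rewrite gerBl mulr_ge0 ?sqr_ge0 // sumr_ge0 // => x _; exact: sqr_ge0.
Qed.

Lemma sqr_sum_le_card (I : finType) (S : {set I}) (g : I -> R) :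
  (\sum_(i in S) g i) ^+ 2 <= #|S|%:R * \sum_(i in S) g i ^+ 2.
Proof.
have [->|/set0Pn[i0 Si0]] := eqVneq S set0.
  by rewrite !big_set0 expr0n mulr0.
have n_gt0 : 0 < #|S|%:R :> R by rewrite ltr0n; apply/card_gt0P; exists i0.
set n : R := #|S|%:R in n_gt0 *; set s := \sum_(i in S) g i.
have : 0 <= \sum_(i in S) (n * g i - s) ^+ 2.
  by apply: sumr_ge0 => i _; exact: sqr_ge0.
have -> : \sum_(i in S) (n * g i - s) ^+ 2 =
    n * (n * (\sum_(i in S) g i ^+ 2) - s ^+ 2).
  transitivity (\sum_(i in S) (n ^+ 2 * g i ^+ 2 - 2 * n * s * g i + s ^+ 2)).
    by apply: eq_bigr => i _; ring.
  rewrite big_split sumrB /= -!mulr_sumr sumr_const -/s -mulr_natl -/n; ring.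
by rewrite pmulr_rge0 // subr_ge0.
Qed.

(** The error D is kept through its square, so that no square root is needed. *)
Lemma weighted_incidence_bound (S : {set F * F}) :
  exists D, \sum_(l in S) Phi l = #|S|%:R * (W * V / q) + D
    /\ D ^+ 2 <= #|S|%:R * (q * W2 * V2).
Proof.
exists (\sum_(l in S) (Phi l - W * V / q)); split.
  by rewrite sumrB sumr_const mulr_natl addrC subrK.
apply: le_trans (sqr_sum_le_card _ _) _.
rewrite ler_wpM2l ?ler0n //; apply: le_trans incidence_variance.
rewrite big_mkcond /=; apply: ler_sum => l _.
by case: ifP => // _; exact: sqr_ge0.
Qed.

End Incidence.

(** * The product of the two energies *)

Section EnergyProduct.
Variables (R : realFieldType) (F : finFieldType).
Implicit Types B C : {set F}.

Lemma sum_quot_repr C : (\sum_x quot_repr C x <= #|C| ^ 2)%N.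
Proof.
rewrite -mulnn -cardsX -sum1_card.
rewrite (partition_big (fun ab : F * F => ab.1 / ab.2) predT) //=.
apply: leq_sum => x _; rewrite /quot_repr sum1_card.
apply: subset_leq_card; apply/subsetP => -[a b].
rewrite !inE /= => /and4P[Ca Cb _ e]; rewrite unfold_in /=.
by rewrite in_setX Ca Cb.
Qed.

(** A representation of x as a ratio is determined by its denominator.  The
    inequality is strict when 0 is in C, as 0 is not allowed as denominator. *)
Lemma quot_repr_le C x : (quot_repr C x <= \sum_(c in C) ((c * x)%R \in C))%N.
Proof.
rewrite /quot_repr -big_mkcondr sum1_card.
have /card_in_imset <- : {in [set ab : F * F |
      [&& ab.1 \in C, ab.2 \in C, ab.2 != 0 & ab.1 / ab.2 == x]] &,
    injective snd}.
  move=> [a b] [a' b']; rewrite !inE /= => /and4P[_ _ nz /eqP <-].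
  by move=> /and4P[_ _ nz' /eqP e] eb; subst b'; rewrite -[a](divfK nz) -e divfK.
apply: subset_leq_card; apply/subsetP => y /imsetP[[a b]].
rewrite !inE /= => /and4P[Ca Cb nz /eqP <-] ->.
by rewrite unfold_in /= Cb mulrC divfK.
Qed.

(** One of the two factors [quot_repr C x] counts elements c in C with
    c * x in C, and by popularity of c * x each of them is worth at least
    E(B)/(2|B|) additive quadruples of B with first entry c * x. *)
Lemma popular_energy_incidences B C : C \subset popular_part B ->
  (add_energy B * (\sum_x quot_repr C x ^ 2) <= 2 * #|B| *
    \sum_(l in setX C B) \sum_x quot_repr C x * diff_repr B (l.1 * x - l.2)%R)%N.
Proof.
move=> /subsetP sCB; rewrite exchange_big /= !big_distrr /=.
apply: leq_sum => x _; rewrite -big_distrr /= -mulnn mulnCA [X in (_ <= X)%N]mulnCA.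
rewrite leq_mul2l; apply/orP; right.
apply: (@leq_trans (add_energy B * \sum_(c in C) ((c * x)%R \in C))%N).
  by rewrite leq_mul2l quot_repr_le orbT.
have -> : (\sum_(l in setX C B) diff_repr B (l.1 * x - l.2)%R =
    \sum_(c in C) energy_at B (c * x)%R)%N.
  rewrite /energy_at [RHS]pair_big /=; apply: eq_bigl => -[c a].
  exact: in_setX.
rewrite !big_distrr /=.
apply: leq_sum => c Cc; case: (boolP (_ \in C)) => [/sCB|]; last by rewrite muln0.
by rewrite muln1 inE => /andP[].
Qed.

(** With u the product of the energies, the incidence bound is
    u <= 2 n (n^6/q + D) with D^2 <= n^2 q u.  Either the main term
    n^6/q dominates, and u <= 4 n^7/q, or D does, and squaring u <= 4 n D
    gives u <= 16 n^4 q. *)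
Lemma energy_product_bound B C (n : nat) :
    C \subset popular_part B -> (#|B| <= n)%N ->
  (add_energy B)%:R * (mul_energy C)%:R <=
    16 * (n%:R ^+ 7 / #|F|%:R + n%:R ^+ 4 * #|F|%:R) :> R.
Proof.
move=> sCP leBn; have leCn : (#|C| <= n)%N.
  apply: leq_trans leBn; apply: subset_leq_card.
  exact: subset_trans sCP (popular_part_sub B).
set q : R := #|F|%:R; have q_gt0 : 0 < q.
  by rewrite ltr0n; apply/card_gt0P; exists 0.
set M : R := \sum_x (quot_repr C x)%:R ^+ 2.
have M_ge0 : 0 <= M by apply: sumr_ge0 => x _; exact: sqr_ge0.
set E : R := (add_energy B)%:R.
have leM : (mul_energy C)%:R <= M.
  rewrite /M /mul_energy natr_sum big_mkcond /=; apply: ler_sum => x _.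
  by case: ifP => _; rewrite ?natrX ?sqr_ge0.
apply: (@le_trans _ _ (E * M)); first by rewrite ler_wpM2l ?ler0n.
have [D [sumPhi leD]] := weighted_incidence_bound
  (fun x => (quot_repr C x)%:R : R) (fun d => (diff_repr B d)%:R) (setX C B).
rewrite cardsX sum_diff_repr sum_sqr_diff_repr -/M -/q -/E in sumPhi leD.
set N : R := n%:R; have N_ge0 : 0 <= N by exact: ler0n.
have leSN : (#|C| * #|B|)%:R <= N ^+ 2 :> R.
  by rewrite -natrX ler_nat -mulnn leq_mul.
set u := E * M; have u_ge0 : 0 <= u by rewrite mulr_ge0 ?ler0n.
have leDN : D ^+ 2 <= N ^+ 2 * (q * u).
  apply: le_trans leD _; rewrite -mulrA [M * E]mulrC.
  by rewrite ler_wpM2r ?mulr_ge0 // ltW.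
have le_u : u <= 2 * N * (N ^+ 6 / q + D).
  set S := \sum_(l in _) _ in sumPhi.
  have S_ge0 : 0 <= S.
    by do 2! [apply: sumr_ge0 => ? _]; rewrite mulr_ge0 ?ler0n.
  have leS : S <= N ^+ 6 / q + D.
    rewrite sumPhi lerD2r mulrA ler_wpM2r ?invr_ge0 ?(ltW q_gt0) //.
    rewrite (_ : N ^+ 6 = N ^+ 2 * (N ^+ 2 * N ^+ 2)); last by ring.
    rewrite ler_pM ?mulr_ge0 ?sumr_ge0 ?ler0n //.
    rewrite ler_pM ?sumr_ge0 ?ler0n // -?natr_sum -natrX ler_nat.
      by apply: leq_trans (sum_quot_repr C) _; rewrite leq_sqr.
    by rewrite leq_sqr.
  have : u <= 2 * #|B|%:R * S.
    have := popular_energy_incidences sCP; rewrite -(ler_nat R) !natrM.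
    congr (_ * _ <= _ * _); rewrite natr_sum; apply: eq_bigr => x _.
      by rewrite natrX.
    by rewrite natr_sum; apply: eq_bigr => y _; rewrite natrM.
  move/le_trans; apply.
  by rewrite ler_pM ?mulr_ge0 ?ler0n ?ler_wpM2l ?ler_nat.
have T_ge0 : 0 <= N ^+ 6 / q by rewrite divr_ge0 ?exprn_ge0 ?(ltW q_gt0).
have qN_ge0 : 0 <= N ^+ 4 * q by rewrite mulr_ge0 ?exprn_ge0 ?(ltW q_gt0).
have -> : N ^+ 7 / q = N * (N ^+ 6 / q) by rewrite exprS mulrA.
have [leDT|ltTD] := lerP D (N ^+ 6 / q).
  have : 2 * N * (N ^+ 6 / q + D) <= 2 * N * (N ^+ 6 / q + N ^+ 6 / q).
    by rewrite ler_wpM2l ?mulr_ge0 // lerD2l.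
  have : 0 <= N * (N ^+ 6 / q) by rewrite mulr_ge0.
  by lra.
have D_ge0 : 0 <= D by apply: le_trans T_ge0 (ltW ltTD).
have le_uD : u <= 4 * N * D.
  have : 2 * N * (N ^+ 6 / q + D) <= 2 * N * (D + D).
    by rewrite ler_wpM2l ?mulr_ge0 // lerD2r ltW.
  by lra.
have : u * u <= 16 * (N ^+ 4 * q) * u.
  have : u * u <= (4 * N * D) * (4 * N * D) by rewrite ler_pM.
  have : N ^+ 2 * D ^+ 2 <= N ^+ 2 * (N ^+ 2 * (q * u)).
    by rewrite ler_wpM2l ?exprn_ge0.
  lra.
have NT_ge0 : 0 <= N * (N ^+ 6 / q) by rewrite mulr_ge0.
have [u_gt0|u_le0] := ltrP 0 u; last by move=> _; lra.
by rewrite ler_pM2r // => ?; lra.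
Qed.

End EnergyProduct.

Theorem theorem2 (R : realType) :
  exists c1 c2 c3 : R, [/\ 0 < c1, 0 < c2, 0 < c3 &
    forall (p k : nat) (F : finFieldType) (A : {set F}),
      prime p -> odd p -> (0 < k)%N -> #|F| = (p ^ k)%N ->
      (2 <= #|A|)%N ->
      exists B C : {set F},
        [/\ C \subset B, B \subset A,
            #|A|%:R <= c1 * #|B|%:R,
            #|B|%:R <= c2 * (ln (#|A|%:R) ^+ 2 * #|C|%:R) &
            (add_energy B)%:R * (mul_energy C)%:R <=
              c3 * (#|A|%:R ^+ 7 * ln (#|A|%:R) / #|F|%:R
                    + #|A|%:R ^+ 4 * ln (#|A|%:R) ^+ 2 * #|F|%:R)]].
Proof.
have l_gt0 : 0 < ln 2 :> R by rewrite ln_gt0 // ltr1n.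
set l : R := ln 2 in l_gt0 *.
(* With t the integer part of log_2 |A|, t + 3 halvings are enough, and
   2 (t + 3) <= 8 t; hence the constant 8, as t ln 2 <= ln |A|. *)
exists 2, (8 / l ^+ 2), (16 * (l^-1 + l^-2)); split.
- by [].
- by rewrite divr_gt0 // exprn_gt0.
- by rewrite mulr_gt0 // addr_gt0 ?invr_gt0 ?exprn_gt0.
move=> _ _ F A _ _ _ _ A_ge2.
have A_gt0 : (0 < #|A|)%N by exact: ltnW.
set n := #|A|; set L : R := ln n%:R.
set t := trunc_log 2 n.
have t_gt0 : (0 < t)%N by rewrite trunc_log_gt0 ?A_ge2.
have lt_J : (4 * n < 2 ^ t.+3)%N.
  have := trunc_log_ltn n (isT : 1 < 2)%N.
  by rewrite -/t !expnS; lia.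
have le_tL : t%:R * l <= L.
  rewrite mulr_natl -lnXn // ler_ln ?posrE ?exprn_gt0 ?ltr0n //.
  by rewrite -natrX ler_nat trunc_logP.
have le_lL : l <= L.
  by apply: le_trans le_tL; rewrite ler_peMl ?(ltW l_gt0) // ler1n.
have [B [sBA leAB leAC]] := exists_large_popular_part A_gt0 lt_J.
exists B, (popular_part B); split => //.
- exact: popular_part_sub.
- by rewrite -natrM ler_nat.
- have leBC : #|B|%:R <= 8 * t%:R * #|popular_part B|%:R :> R.
    rewrite -!natrM ler_nat; apply: leq_trans (subset_leq_card sBA) _.
    apply: leq_trans leAC _; rewrite leq_mul2r; apply/orP; right; lia.
  apply: le_trans leBC _; rewrite mulrA ler_wpM2r ?ler0n //.
  rewrite -mulrA ler_wpM2l // mulrC ler_pdivlMr ?exprn_gt0 //.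
  rewrite expr2 mulrA [L ^+ 2]expr2 ler_pM ?mulr_ge0 ?ler0n ?(ltW l_gt0) //.
apply: le_trans (energy_product_bound R (subxx _) (subset_leq_card sBA)) _.
rewrite -[X in _ <= X]mulrA ler_wpM2l // -/n.

have L_ge1 : 1 <= l^-1 * L by rewrite mulrC ler_pdivlMr // mul1r.
have L2_ge1 : 1 <= l^-2 * L ^+ 2.
  by rewrite -exprVn -exprMn exprn_ege1.
have X_ge0 : 0 <= n%:R ^+ 7 / #|F|%:R :> R by rewrite divr_ge0 ?exprn_ge0.
have Y_ge0 : 0 <= n%:R ^+ 4 * #|F|%:R :> R by rewrite mulr_ge0 ?exprn_ge0.
have L_ge0 : 0 <= L by apply: le_trans le_lL; exact: ltW.
have il : 0 <= l^-1 by rewrite invr_ge0 ltW.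
have il2 : 0 <= l^-2 by rewrite invr_ge0 exprn_ge0 // ltW.
rewrite [n%:R ^+ 7 * L / _]mulrAC [n%:R ^+ 4 * L ^+ 2 * _]mulrAC.
set X := n%:R ^+ 7 / _ in X_ge0 *; set Y := n%:R ^+ 4 * _ in Y_ge0 *.
have XL : 0 <= X * L by rewrite mulr_ge0.
have YL : 0 <= Y * L ^+ 2 by rewrite mulr_ge0 ?exprn_ge0.
apply: (@le_trans _ _ (X * (l^-1 * L) + Y * (l^-2 * L ^+ 2))).
  by rewrite lerD // ler_peMr.
rewrite mulrCA [Y * _]mulrCA mulrDl !mulrDr.
have : 0 <= l^-1 * (Y * L ^+ 2) by rewrite mulr_ge0.
have : 0 <= l^-2 * (X * L) by rewrite mulr_ge0.
lra.
Qed.
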